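(* Let $n\geq 2$, let $R\subseteq R_i$ ($i=1,\ldots,n$) be finitely many ring extensions, let $\mathcal R:=\prod_{i=1}^nR_i$, and regard $R\subseteq\mathcal R$ as a ring extension via the diagonal map $r\mapsto(r,\ldots,r)$. Then: (1) $\mathrm{Supp}_R(\mathcal R/R)=\mathrm{Spec}(R)$. (2) If $R\subseteq\mathcal R$ has FCP (respectively, FIP), then $R$ is an Artinian ring and each extension $R\subseteq R_i$ has FCP (respectively, FIP). (3) If $R\subseteq\mathcal R$ has FIP, then $R$ has only finitely many ideals.
   Context: All rings are commutative, unital and nonzero; ring morphisms are unital. For a ring extension $R\subseteq S$, $[R,S]$ denotes the set of all $R$-subalgebras of $S$ (i.e. subrings $T$ with $R\subseteq T\subseteq S$). The extension has FIP if $[R,S]$ is finite, and FCP if every chain (with respect to inclusion) of elements of $[R,S]$ is finite. For an $R$-module $E$, $\mathrm{Supp}_R(E)=\{P\in\mathrm{Spec}(R)\mid E_P\neq0\}$. *)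

(* Defs.v *)
(* A ring extension R \subseteq S is an R-algebra S whose structure map
   in_alg S : r |-> r%:A is injective; R is identified with its image. *)
From HB Require Import structures.
From mathcomp Require Import all_boot all_order all_algebra.
From mathcomp Require Import ring all_classical.

Set Implicit Arguments.
Unset Strict Implicit.
Unset Printing Implicit Defensive.

Import GRing.Theory.

Local Open Scope ring_scope.
Local Open Scope quotient_scope.
Local Open Scope classical_set_scope.

Definition extension (R : comNzRingType) (S : comAlgType R) : Prop :=
  injective (@GRing.in_alg R S).

(* The product of the S i. The proof that the index type is inhabited is only
   used to make the product a nonzero ring. *)
Definition prodalg (R : comNzRingType) (n : nat) (n_gt0 : (0 < n)%N)
  (S : 'I_n -> comAlgType R) : Type := forall i, S i.

Section ProductAlgebra.
Variables (R : comNzRingType) (n : nat) (n_gt0 : (0 < n)%N).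
Variable S : 'I_n -> comAlgType R.
Local Notation prodS := (prodalg n_gt0 S).
Implicit Types x y z : prodS.

HB.instance Definition _ := Choice.copy prodS (forall i, S i).

Fact prodalgP x y : (forall i, x i = y i) -> x = y.
Proof. exact: functional_extensionality_dep. Qed.

Definition prodalg_zero : prodS := fun=> 0.
Definition prodalg_opp x : prodS := fun i => - x i.
Definition prodalg_add x y : prodS := fun i => x i + y i.

Fact prodalg_addA : associative prodalg_add.
Proof. by move=> x y z; apply/prodalgP => i; exact: addrA. Qed.
Fact prodalg_addC : commutative prodalg_add.
Proof. by move=> x y; apply/prodalgP => i; exact: addrC. Qed.
Fact prodalg_add0 : left_id prodalg_zero prodalg_add.
Proof. by move=> x; apply/prodalgP => i; exact: add0r. Qed.
Fact prodalg_addN : left_inverse prodalg_zero prodalg_opp prodalg_add.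
Proof. by move=> x; apply/prodalgP => i; exact: addNr. Qed.

HB.instance Definition _ := GRing.isZmodule.Build prodS
  prodalg_addA prodalg_addC prodalg_add0 prodalg_addN.

Definition prodalg_one : prodS := fun=> 1.
Definition prodalg_mul x y : prodS := fun i => x i * y i.

Fact prodalg_mulA : associative prodalg_mul.
Proof. by move=> x y z; apply/prodalgP => i; exact: mulrA. Qed.
Fact prodalg_mulC : commutative prodalg_mul.
Proof. by move=> x y; apply/prodalgP => i; exact: mulrC. Qed.
Fact prodalg_mul1 : left_id prodalg_one prodalg_mul.
Proof. by move=> x; apply/prodalgP => i; exact: mul1r. Qed.
Fact prodalg_mulDl : left_distributive prodalg_mul +%R.
Proof. by move=> x y z; apply/prodalgP => i; exact: mulrDl. Qed.
Fact prodalg_oner_neq0 : prodalg_one != 0.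
Proof.
apply/eqP => /(congr1 (fun x : prodS => x (Ordinal n_gt0))) /eqP.
by rewrite oner_eq0.
Qed.

HB.instance Definition _ := GRing.Zmodule_isComNzRing.Build prodS
  prodalg_mulA prodalg_mulC prodalg_mul1 prodalg_mulDl prodalg_oner_neq0.

Definition prodalg_scale (a : R) x : prodS := fun i => a *: x i.

Fact prodalg_scaleA a b x :
  prodalg_scale a (prodalg_scale b x) = prodalg_scale (a * b) x.
Proof. by apply/prodalgP => i; exact: scalerA. Qed.
Fact prodalg_scale1 : left_id 1 prodalg_scale.
Proof. by move=> x; apply/prodalgP => i; exact: scale1r. Qed.
Fact prodalg_scaleDr : right_distributive prodalg_scale +%R.
Proof. by move=> a x y; apply/prodalgP => i; exact: scalerDr. Qed.
Fact prodalg_scaleDl x : {morph prodalg_scale^~ x : a b / a + b}.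
Proof. by move=> a b; apply/prodalgP => i; exact: scalerDl. Qed.

HB.instance Definition _ := GRing.Zmodule_isLmodule.Build R prodS
  prodalg_scaleA prodalg_scale1 prodalg_scaleDr prodalg_scaleDl.

Fact prodalg_scaleAl (a : R) x y : a *: (x * y) = (a *: x) * y.
Proof. by apply/prodalgP => i; exact: scalerAl. Qed.

HB.instance Definition _ :=
  GRing.Lmodule_isLalgebra.Build R prodS prodalg_scaleAl.
HB.instance Definition _ := GRing.Lalgebra_isComAlgebra.Build R prodS.

(* The structure map of the product is the diagonal map. *)
Lemma prodalg_in_algE (r : R) :
  GRing.in_alg prodS r = (fun i => GRing.in_alg (S i) r).
Proof. by []. Qed.

Lemma prodalg_extension : (forall i, extension (S i)) -> extension prodS.
Proof.
move=> extS r s /(congr1 (fun x : prodS => x (Ordinal n_gt0))).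
exact: extS.
Qed.

End ProductAlgebra.

(* [R, S]: such a T contains R because it contains 1 and is stable under
   scaling by R. *)
Definition intermediate (R : comNzRingType) (S : comAlgType R) : set (set S) :=
  [set T : set S | GRing.subalg_closed [in T]].
Arguments intermediate {R} S _.

Definition FIP (R : comNzRingType) (S : comAlgType R) : Prop :=
  finite_set (intermediate S).

Definition FCP (R : comNzRingType) (S : comAlgType R) : Prop :=
  forall C : set (set S),
    C `<=` intermediate S -> total_on C subset -> finite_set C.

(* The library's idealr_closed only covers proper ideals; here the unit ideal
   is included. *)
Definition ideals (R : comNzRingType) : set (set R) :=
  [set J : set R | @GRing.submod_closed R R^o [in J]].
Arguments ideals R _ : clear implicits.

Definition artinian (R : comNzRingType) : Prop :=
  forall J : nat -> set R,
    (forall k, ideals R (J k)) -> (forall k, J k.+1 `<=` J k) ->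
    exists m, forall k, (m <= k)%N -> J k = J m.

Definition base_image (R : comNzRingType) (S : comAlgType R) : pred S :=
  fun x => `[< range (@GRing.in_alg R S) x >].

Section QuotientModule.
Variables (R : comNzRingType) (S : comAlgType R).

Fact base_image_submod : GRing.submod_closed (@base_image R S).
Proof.
split; first by apply/asboolP; exists 0 => //; exact: scale0r.
move=> a _ _ /asboolP[r _ <-] /asboolP[s _ <-]; apply/asboolP.
by exists (a * r + s) => //; rewrite /GRing.in_alg scalerDl scalerA.
Qed.

HB.instance Definition _ :=
  GRing.isSubmodClosed.Build R S (@base_image R S)
    (GRing.submod_closed_semi base_image_submod).

Let base_zmod : zmodClosed S := GRing.ZmodClosed.clone S (@base_image R S) _.

(* The library only makes {quot _} a zmodType; this is the R-module S / R. *)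
Definition extquot : Type := Quotient.quot base_zmod.

HB.instance Definition _ := GRing.Zmodule.on extquot.
HB.instance Definition _ := EqQuotient.on extquot.

Definition extquot_scale (a : R) (x : extquot) : extquot :=
  \pi_extquot (a *: repr x).

Fact extquot_pi_eq (x y : S) :
  (\pi_extquot x == \pi_extquot y) = (x - y \in @base_image R S).
Proof. by rewrite [RHS](Quotient.idealrBE base_zmod). Qed.

Fact extquot_piD (x y : S) :
  \pi_extquot (x + y) = \pi_extquot x + \pi_extquot y.
Proof. exact: (Quotient.pi_add base_zmod). Qed.

Fact extquot_pi0 : \pi_extquot 0 = 0.
Proof.
by apply: (addrI (\pi_extquot 0)); rewrite -extquot_piD !addr0.
Qed.

Fact extquot_piZ (a : R) (x : S) :
  \pi_extquot (a *: x) = extquot_scale a (\pi_extquot x).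
Proof.
apply/eqP; rewrite extquot_pi_eq -scalerBr; apply: rpredZ.
by rewrite -extquot_pi_eq reprK.
Qed.

Fact extquot_scaleA a b x :
  extquot_scale a (extquot_scale b x) = extquot_scale (a * b) x.
Proof.
elim/quotW: x => x.
by rewrite -(extquot_piZ b x) -(extquot_piZ a) -(extquot_piZ (a * b)) scalerA.
Qed.
Fact extquot_scale1 : left_id 1 extquot_scale.
Proof. by elim/quotW=> x; rewrite -extquot_piZ scale1r. Qed.
Fact extquot_scaleDr : right_distributive extquot_scale +%R.
Proof.
move=> a; elim/quotW=> x; elim/quotW=> y.
by rewrite -extquot_piD -(extquot_piZ a) -(extquot_piZ a x) -(extquot_piZ a y)
   -extquot_piD scalerDr.
Qed.
Fact extquot_scaleDl x : {morph extquot_scale^~ x : a b / a + b}.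
Proof.
elim/quotW: x => x a b /=.
by rewrite -(extquot_piZ a x) -(extquot_piZ b x) -extquot_piZ -extquot_piD
   scalerDl.
Qed.

HB.instance Definition _ := GRing.Zmodule_isLmodule.Build R extquot
  extquot_scaleA extquot_scale1 extquot_scaleDr extquot_scaleDl.

End QuotientModule.
Arguments extquot {R} S.

Definition Spec (R : comNzRingType) : Type :=
  {P : set R | idealr_closed [in P] /\ prime_idealr_closed [in P]}.

Section Localization.
Variables (R : comNzRingType) (P : Spec R) (E : lmodType R).

Definition denominator : Type := {s : R | s \notin sval P}.
HB.instance Definition _ := Choice.on denominator.

Fact denominator1_subproof : (1 : R) \notin sval P.
Proof. by have [[_]] := svalP P. Qed.
Fact denominatorM_subproof (s t : denominator) :
  sval s * sval t \notin sval P.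
Proof.
have [_ primeP] := svalP P; apply/negP => /primeP.
by rewrite (negPf (svalP s)) (negPf (svalP t)).
Qed.

Definition denominator1 : denominator := exist _ 1 denominator1_subproof.
Definition denominatorM (s t : denominator) : denominator :=
  exist _ (sval s * sval t) (denominatorM_subproof s t).

(* Pairs (m, s), read m / s; the extra denominator u in the equivalence is
   needed because R may have zero divisors and E may have torsion. *)
Definition fracs : Type := (E * denominator)%type.
HB.instance Definition _ := Choice.on fracs.

Definition loc_eq (x y : fracs) : bool :=
  `[< exists u : denominator,
        sval u *: (sval y.2 *: x.1) = sval u *: (sval x.2 *: y.1) >].

Fact loc_eq_refl : reflexive loc_eq.
Proof. by move=> x; apply/asboolP; exists denominator1. Qed.

Fact loc_eq_sym : symmetric loc_eq.
Proof. by move=> x y; apply/asboolP/asboolP => -[u eu]; exists u. Qed.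

Fact loc_eq_trans : transitive loc_eq.
Proof.
move=> y x z /asboolP[u xy] /asboolP[v yz]; apply/asboolP.
exists (denominatorM (denominatorM u v) y.2) => /=.
move: xy yz; rewrite !scalerA => xy yz.
transitivity ((sval v * sval z.2) *: ((sval u * sval y.2) *: x.1)).
  by rewrite scalerA; congr (_ *: _); ring.
rewrite xy scalerA.
transitivity ((sval u * sval x.2) *: ((sval v * sval z.2) *: y.1)).
  by rewrite scalerA; congr (_ *: _); ring.
by rewrite yz scalerA; congr (_ *: _); ring.
Qed.

Canonical loc_eq_equiv := EquivRel loc_eq loc_eq_refl loc_eq_sym loc_eq_trans.

Definition localization : Type := {eq_quot loc_eq}.

HB.instance Definition _ := EqQuotient.on localization.
HB.instance Definition _ := Choice.on localization.

Definition fracs_add (x y : fracs) : fracs :=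
  (sval y.2 *: x.1 + sval x.2 *: y.1, denominatorM x.2 y.2).
Definition fracs_opp (x : fracs) : fracs := (- x.1, x.2).

Definition loc_zero : localization := \pi_localization (0, denominator1).
Definition loc_add (x y : localization) : localization :=
  \pi_localization (fracs_add (repr x) (repr y)).
Definition loc_opp (x : localization) : localization :=
  \pi_localization (fracs_opp (repr x)).

Lemma loc_piP (x y : fracs) :
  reflect (exists u : denominator,
             sval u *: (sval y.2 *: x.1) = sval u *: (sval x.2 *: y.1))
          (\pi_localization x == \pi_localization y).
Proof. by rewrite eqmodE; exact: asboolP. Qed.

Lemma loc_reprP (x : fracs) : exists u : denominator,
  sval u *: (sval (repr (\pi_localization x)).2 *: x.1)
  = sval u *: (sval x.2 *: (repr (\pi_localization x)).1).
Proof. by apply/loc_piP; rewrite reprK. Qed.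

Lemma loc_piD (x y : fracs) :
  \pi_localization (fracs_add x y) =
    loc_add (\pi_localization x) (\pi_localization y).
Proof.
have [u xE] := loc_reprP x; have [v yE] := loc_reprP y.
apply/eqP/loc_piP; exists (denominatorM u v) => /=.
move: (repr _) (repr _) xE yE => y' x'; rewrite !scalerA => xE yE.
rewrite !scalerDr !scalerA; congr (_ + _).
  transitivity ((sval v * sval y.2 * sval y'.2)
                *: ((sval u * sval x'.2) *: x.1)).
    by rewrite scalerA; congr (_ *: _); ring.
  by rewrite xE scalerA; congr (_ *: _); ring.
transitivity ((sval u * sval x.2 * sval x'.2)
              *: ((sval v * sval y'.2) *: y.1)).
  by rewrite scalerA; congr (_ *: _); ring.
by rewrite yE scalerA; congr (_ *: _); ring.
Qed.

Lemma loc_piN (x : fracs) :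
  \pi_localization (fracs_opp x) = loc_opp (\pi_localization x).
Proof.
have [u xE] := loc_reprP x; apply/eqP/loc_piP; exists u => /=.
by rewrite !scalerN xE.
Qed.

Fact loc_addA : associative loc_add.
Proof.
elim/quotW=> x; elim/quotW=> y; elim/quotW=> z.
rewrite -(loc_piD y z) -(loc_piD x y) -(loc_piD x) -(loc_piD _ z).
apply/eqP/loc_piP; exists denominator1 => /=.
rewrite !scale1r !scalerDr !scalerA !addrA.
by congr (_ *: _ + _ *: _ + _ *: _); ring.
Qed.
Fact loc_addC : commutative loc_add.
Proof.
elim/quotW=> x; elim/quotW=> y; rewrite -(loc_piD x y) -(loc_piD y x).
apply/eqP/loc_piP; exists denominator1 => /=.
by rewrite addrC [sval y.2 * _]mulrC.
Qed.
Fact loc_add0 : left_id loc_zero loc_add.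
Proof.
elim/quotW=> x; rewrite -(loc_piD (0, denominator1) x).
apply/eqP/loc_piP; exists denominator1 => /=.
by rewrite scaler0 add0r !scale1r mul1r.
Qed.
Fact loc_addN : left_inverse loc_zero loc_opp loc_add.
Proof.
elim/quotW=> x; rewrite -(loc_piN x) -(loc_piD (fracs_opp x) x).
apply/eqP/loc_piP; exists denominator1 => /=.
by rewrite scalerN addNr !scaler0.
Qed.

HB.instance Definition _ := GRing.isZmodule.Build localization
  loc_addA loc_addC loc_add0 loc_addN.

End Localization.

Definition Supp (R : comNzRingType) (E : lmodType R) : set (Spec R) :=
  [set P | exists x : localization P E, x != 0].

(* Main.v *)
Require Import Defs.
From HB Require Import structures.
From mathcomp Require Import all_boot all_order all_algebra.
From mathcomp Require Import ring all_classical.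

(** The whole statement rests on one element of the product: the idempotent
    [e = (1, 0, ..., 0)].  If [a e = (a, 0, ..., 0)] is a diagonal element
    [(r, ..., r)] then [r = 0], by comparing second coordinates (this is where
    [n >= 2] enters), hence [a = 0].  In other words the class of [e] generates
    a free submodule of the quotient by [R].

    The support is then everything, because a free submodule has a nonzero
    localization at every prime ([Supp_free_mod_base]).  Moreover [R + J e] is,
    for every ideal [J], an intermediate ring, since [e] is idempotent
    ([ideal_adjunction_intermediate]), and [J] is recovered from it as the set
    of the [j] with [j e] in [R + J e] ([ideal_adjunctionE]).  So the ideals of
    [R] embed, as an ordered set, into the intermediate rings: FCP forces every
    descending chain of ideals to take finitely many values, and FIP forces the
    set of ideals to be finite.

    Finally the preimage map along the surjective projection on a factor embeds
    the intermediate rings of that factor, again as an ordered set, into those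
    of the product, so both finiteness conditions descend to the factors
    ([FCP_surj], [FIP_surj]). *)

Set Implicit Arguments.
Unset Strict Implicit.
Unset Printing Implicit Defensive.

Import GRing.Theory.

Local Open Scope ring_scope.
Local Open Scope quotient_scope.
Local Open Scope classical_set_scope.

Lemma finite_set_inj (T U : Type) (f : T -> U) (A : set T) :
  injective f -> finite_set (f @` A) -> finite_set A.
Proof.
move=> inj_f fin_fA.
apply: (@sub_finite_set _ _ (f @^-1` (f @` A))); first by move=> x Ax; exists x.
by apply: finite_preimage => // x y _ _; exact: inj_f.
Qed.

Lemma decreasing_subset (T : Type) (J : nat -> set T) (k m : nat) :
  (forall k, J k.+1 `<=` J k) -> (m <= k)%N -> J k `<=` J m.
Proof.
move=> decrJ /subnK <-; elim: (k - m)%N => [|d IHd] //.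
by rewrite addSn; exact: subset_trans (decrJ _) IHd.
Qed.

(** Every value has an index at which it is taken; past the largest of these
    finitely many indices, each term is squeezed between itself and an earlier
    occurrence of itself. *)
Lemma finite_range_decreasing_stable (T : Type) (J : nat -> set T) :
    (forall k, J k.+1 `<=` J k) -> finite_set (range J) ->
  exists m, forall k, (m <= k)%N -> J k = J m.
Proof.
move=> decrJ /finite_seqP[s rangeJ].
have /choice[h hP] : forall X : set T, exists k, range J X -> J k = X.
  move=> X; have [[k _ <-]|noX] := pselect (range J X); first by exists k.
  by exists 0%N.
exists (\max_(X <- s) h X) => k lemk.
have rangeJk : range J (J k) by exists k.
apply/seteqP; split; first exact: decreasing_subset.
rewrite -[X in _ `<=` X](hP _ rangeJk); apply: decreasing_subset => //.
by apply: leq_bigmax_seq => //; move: rangeJk; rewrite rangeJ.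
Qed.

(** The class of [x] generates a free submodule of [S / R]; the condition is
    stated in [S] itself, which avoids the quotient in all but one use. *)
Definition free_mod_base (R : comNzRingType) (S : comAlgType R) (x : S) : Prop :=
  forall a : R, range (@GRing.in_alg R S) (a *: x) -> a = 0.

(** The fraction [x / 1] vanishes only if some denominator [u] sends [x] into
    the base ring; freeness gives [u = 0], which lies in every prime. *)
Lemma Supp_free_mod_base (R : comNzRingType) (S : comAlgType R) (x : S) :
  free_mod_base x -> Supp (extquot S) = [set: Spec R].
Proof.
move=> free_x; apply/seteqP; split=> // P _.
exists (\pi_(localization P (extquot S)) (\pi_(extquot S) x, denominator1 P)).
apply/negP => /(@loc_piP R P (extquot S) _ (0, denominator1 P)) [u /=].
rewrite !scale1r scaler0 -[_ *: _]/(extquot_scale _ _) -extquot_piZ.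
rewrite -(extquot_pi0 S) => /eqP.
rewrite extquot_pi_eq subr0 => /asboolP /free_x u0.
by have [[P0 _ _] _] := svalP P; have := svalP u; rewrite u0 P0.
Qed.

Section IdealAdjunction.
Variables (R : comNzRingType) (S : comAlgType R) (e : S).

(** Usually written [R + J e]. *)
Definition ideal_adjunction (J : set R) : set S :=
  [set x | exists r, exists2 j, J j & x = r%:A + j *: e].

Lemma ideal_adjunction_intermediate (J : set R) :
  e * e = e -> ideals R J -> intermediate S (ideal_adjunction J).
Proof.
move=> ee [J0 Jlin].
have {}J0 : J 0 by move: J0; rewrite inE.
have {}Jlin a u v : J u -> J v -> J (a * u + v).
  by move=> Ju Jv; have := Jlin a u v; rewrite !inE => /(_ Ju Jv).
have JD u v : J u -> J v -> J (u + v).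
  by move=> Ju Jv; rewrite -[u]mul1r; exact: Jlin.
have JM a u : J u -> J (a * u) by move=> Ju; rewrite -[_ * _]addr0; exact: Jlin.
split; first by rewrite inE; exists 1, 0 => //; rewrite scale1r scale0r addr0.
  move=> a x y; rewrite !inE => -[r [j Jj ->]] [s [k Jk ->]].
  exists (a * r + s), (a * j + k); first exact: Jlin.
  by rewrite scalerDr !scalerA !scalerDl addrACA.
move=> x y; rewrite !inE => -[r [j Jj ->]] [s [k Jk ->]].
(* [(r + j e) (s + k e) = r s + (r k + s j + j k) e], as [e] is idempotent. *)
exists (r * s), (r * k + (s * j + j * k)).
  by apply: (JD) (JM _ _ Jk) _; apply: JD; exact: JM.
rewrite mulrDl !mulrDr -!scalerAl -!scalerAr !mul1r mulr1 ee !scalerA.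
by rewrite !scalerDl [s * j]mulrC !addrA.
Qed.

Lemma ideal_adjunctionS (J K : set R) :
  J `<=` K -> ideal_adjunction J `<=` ideal_adjunction K.
Proof. by move=> JK x [r [j /JK Kj ->]]; exists r, j. Qed.

Hypothesis free_e : free_mod_base e.

(** If [j e = r + k e] with [k] in [J] then [(j - k) e] lies in [R], so that
    [j = k] by freeness.  This is what recovers [J] from [R + J e]. *)
Lemma ideal_adjunctionE (J : set R) (j : R) : ideal_adjunction J (j *: e) <-> J j.
Proof.
split=> [[r [k Jk jeE]]|Jj]; last by exists 0, j => //; rewrite scale0r add0r.
suff /eqP : j - k = 0 by rewrite subr_eq0 => /eqP ->.
by apply: free_e; exists r => //; rewrite scalerBl jeE addrK.
Qed.

Lemma ideal_adjunction_inj : injective ideal_adjunction.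
Proof.
move=> J K eqJK; apply/seteqP; split=> j.
  by move/ideal_adjunctionE; rewrite eqJK => /ideal_adjunctionE.
by move/ideal_adjunctionE; rewrite -eqJK => /ideal_adjunctionE.
Qed.

Hypothesis idem_e : e * e = e.

(** The rings [R + J_k e] of a descending chain of ideals form a chain, so only
    finitely many of them, hence of the [J_k], are distinct. *)
Lemma FCP_artinian : FCP S -> artinian R.
Proof.
move=> fcpS J idJ decrJ; apply: finite_range_decreasing_stable => //.
apply: (finite_set_inj ideal_adjunction_inj); apply: fcpS.
  by move=> _ [_ [k _ <-] <-]; exact: ideal_adjunction_intermediate.
move=> _ _ [_ [k _ <-] <-] [_ [m _ <-] <-].
by have [km|/ltnW mk] := leqP k m; [right|left];
  apply: ideal_adjunctionS; exact: decreasing_subset.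
Qed.

Lemma FIP_finite_ideals : FIP S -> finite_set (ideals R).
Proof.
move=> fipS; apply: (finite_set_inj ideal_adjunction_inj).
apply: sub_finite_set fipS => _ [J idJ <-].
exact: ideal_adjunction_intermediate.
Qed.

End IdealAdjunction.

Lemma FIP_FCP (R : comNzRingType) (S : comAlgType R) : FIP S -> FCP S.
Proof. by move=> fipS C sC _; exact: sub_finite_set fipS. Qed.

Section Surjection.
Variables (R : comNzRingType) (S S' : comAlgType R).
Variable f : {lrmorphism S -> S'}.
Hypothesis surj_f : forall y, exists x, f x = y.

Lemma intermediate_preimage (T : set S') :
  intermediate S' T -> intermediate S (f @^-1` T).
Proof.
case=> T1 Tlin TM; split=> [|a x y|x y]; rewrite !inE /=.
- by rewrite rmorph1; move: T1; rewrite inE.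
- move=> Tx Ty; rewrite linearP.
  by have := Tlin a (f x) (f y); rewrite !inE; exact.
- move=> Tx Ty; rewrite rmorphM.
  by have := TM (f x) (f y); rewrite !inE; exact.
Qed.

Lemma preimage_surj_inj : injective (fun T : set S' => f @^-1` T).
Proof.
by move=> T U eqTU; apply/seteqP; split=> y; have [x <-] := surj_f y;
  move: (congr1 (fun A : set S => A x) eqTU) => /= ->.
Qed.

Lemma FIP_surj : FIP S -> FIP S'.
Proof.
move=> fipS; apply: (finite_set_inj preimage_surj_inj).
by apply: sub_finite_set fipS => _ [T iT <-]; exact: intermediate_preimage.
Qed.

Lemma FCP_surj : FCP S -> FCP S'.
Proof.
move=> fcpS C sC totC; apply: (finite_set_inj preimage_surj_inj).
apply: fcpS => [_ [T CT <-]|_ _ [T CT <-] [U CU <-]].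
  exact/intermediate_preimage/sC.
by have [TU|UT] := totC T U CT CU; [left|right] => x; [exact: TU|exact: UT].
Qed.

End Surjection.

Section Product.
Variables (R : comNzRingType) (n : nat) (n_gt0 : (0 < n)%N).
Variable S : 'I_n -> comAlgType R.
Local Notation prodS := (prodalg n_gt0 S).

(** A named constant, because the structure of algebra morphism has to be
    attached to one. *)
Definition prodalg_proj (i : 'I_n) (x : prodS) : S i := x i.

Section Projection.
Variable i : 'I_n.

Fact prodalg_proj_zmod : zmod_morphism (prodalg_proj i).
Proof. by []. Qed.
HB.instance Definition _ :=
  GRing.isZmodMorphism.Build prodS (S i) (prodalg_proj i) prodalg_proj_zmod.

Fact prodalg_proj_monoid : monoid_morphism (prodalg_proj i).
Proof. by []. Qed.
HB.instance Definition _ :=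
  GRing.isMonoidMorphism.Build prodS (S i) (prodalg_proj i) prodalg_proj_monoid.

Fact prodalg_proj_scalable : scalable (prodalg_proj i).
Proof. by []. Qed.
HB.instance Definition _ :=
  GRing.isScalable.Build R prodS (S i) *:%R (prodalg_proj i)
    prodalg_proj_scalable.

Lemma prodalg_proj_surj (y : S i) : exists x, prodalg_proj i x = y.
Proof. by exists (dfwith (0 : prodS) i y); exact: dfwithin. Qed.

End Projection.

Definition prodalg_idem (i : 'I_n) : prodS := fun j => (j == i)%:R.

Lemma prodalg_idemM i : prodalg_idem i * prodalg_idem i = prodalg_idem i.
Proof.
by apply/prodalgP => j; rewrite /GRing.mul/= /prodalg_mul -natrM mulnb andbb.
Qed.

(** If [a e] is the diagonal element of [r], its coordinate [j] gives [r = 0]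
    and then its coordinate [i] gives [a = 0]. *)
Lemma prodalg_idem_free (i j : 'I_n) : i != j ->
  extension (S i) -> extension (S j) -> free_mod_base (prodalg_idem i).
Proof.
move=> neq_ij exti extj a [r _ rE].
have coord k : r%:A = a *: ((k == i)%:R : S k).
  exact: (congr1 (prodalg_proj k) rE).
have r0 : r = 0.
  apply: extj; rewrite /GRing.in_alg/= (coord j).
  by rewrite eq_sym (negPf neq_ij) scaler0 scale0r.
by apply: exti; rewrite /GRing.in_alg/= scale0r; move: (coord i);
  rewrite eqxx r0 scale0r.
Qed.

End Product.

Theorem proposition2p2 (R : comNzRingType) (n : nat) (n_ge2 : (2 <= n)%N)
    (S : 'I_n -> comAlgType R) (extS : forall i, extension (S i)) :
  let prodS : comAlgType R := prodalg (ltnW n_ge2) S in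
  [/\ Supp (extquot prodS) = [set: Spec R],
      (FCP prodS -> artinian R /\ forall i, FCP (S i))
      /\ (FIP prodS -> artinian R /\ forall i, FIP (S i))
    & FIP prodS -> finite_set (ideals R)].
Proof.
move=> prodS.
pose i0 : 'I_n := Ordinal (ltnW n_ge2); pose i1 : 'I_n := Ordinal n_ge2.
pose e : prodS := prodalg_idem (ltnW n_ge2) S i0.
have free_e : free_mod_base e by exact: (@prodalg_idem_free _ _ _ _ i0 i1).
have idem_e : e * e = e by exact: prodalg_idemM.
split; first exact: Supp_free_mod_base free_e.
  split=> [fcp|fip]; split.
  - exact: FCP_artinian free_e idem_e fcp.
  - by move=> i; exact: FCP_surj (@prodalg_proj_surj _ _ (ltnW n_ge2) S i) fcp.
  - exact: FCP_artinian free_e idem_e (FIP_FCP fip).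
  - by move=> i; exact: FIP_surj (@prodalg_proj_surj _ _ (ltnW n_ge2) S i) fip.
exact: FIP_finite_ideals free_e idem_e.
Qed.
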